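(* Let $p\in(0,1]$ and let $M_1,M_2$ be functions on $[0,1]$ such that $t\mapsto M_1(t^{1/p})$ and $t\mapsto M_2(t^{1/p})$ are Orlicz functions, with fundamental functions $\varphi_{M_1},\varphi_{M_2}$. Assume that $\varphi_{M_1}/\varphi_{M_2}$ is non-decreasing on $[1,\infty)$. Let $m\in\mathbb{N}$ with $m\ge5$ and let $E_0,E_1,\dots,E_{m+1}$ be non-empty, pairwise disjoint, finite or countable sets such that $\sharp E_i\le 2^{m+2^i}$ for all $i=0,1,\dots,m$ (it is possible that $\sharp E_{m+1}=\infty$). Define $$\omega_i=\begin{cases}\dfrac{\varphi_{M_1}(2^{m-i})}{\varphi_{M_2}(2^{m-i})}&\text{if }i=0,1,\dots,m,\\[2mm]1&\text{if }i=m+1.\end{cases}$$ Put $E=\bigcup_{i=0}^{m+1}E_i$ and let $T_\omega:\ell_{M_1}(E)\to\ell_{M_2}(E)$ be the linear map $(T_\omega x)(j)=\omega_i x(j)$ for $j\in E_i$, $i=0,\dots,m+1$. Then $$e_{10\cdot2^m}\left(T_\omega:\ell_{M_1}(E)\to\ell_{M_2}(E)\right)\le c(p),\qquad c(p)=4\cdot2^{12/p}\left(\log\tfrac{24}{p}\right)^{2/p}\left(\tfrac1p\right)^{1/p}.$$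
   Context: All spaces are real; $\log=\log_2$; $\mathbb{N}=\{1,2,\dots\}$; $\sharp$ denotes cardinality. Orlicz function: a continuous, strictly increasing, convex function $N:[0,1]\to\mathbb{R}$ with $N(0)=0$, $N(1)=1$. For $M$ on $[0,1]$ such that $t\mapsto M(t^{1/p})$ is an Orlicz function for some $p\in(0,1]$, and $E$ a non-empty finite or countable set, $\ell_M(E)=\{x:E\to\mathbb{R}:\ \sum_{j\in E}M(|x(j)|/\varrho)<\infty\text{ for some }\varrho>0\}$ with the $p$-norm $\|x\|_{\ell_M(E)}=\inf\{\varrho>0:\ \sum_{j\in E}M(|x(j)|/\varrho)\le1\}$. Convention: $M(t)=+\infty$ for $t>1$, so only $\varrho$ with $|x(j)|\le\varrho$ for all $j$ are admissible. Fundamental function: $\varphi_M(t)=1/M^{-1}(1/t)$ for $t\ge1$. Entropy numbers: for a continuous linear map $T:X\to Y$ between quasi-Banach spaces with closed unit balls $B_X,B_Y$, $e_k(T)=\inf\{\varepsilon>0:\ T(B_X)\subset\bigcup_{i=1}^{2^{k-1}}(y_i+\varepsilon B_Y)\text{ for some }y_1,\dots,y_{2^{k-1}}\in Y\}$. *)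

(* Defs.v *)
From HB Require Import structures.
From mathcomp Require Import all_boot all_order all_algebra.
From mathcomp Require Import all_classical all_reals all_analysis.

Set Implicit Arguments.
Unset Strict Implicit.
Unset Printing Implicit Defensive.

Import Order.TTheory GRing.Theory Num.Theory.
Import numFieldNormedType.Exports.

Local Open Scope classical_set_scope.
Local Open Scope ring_scope.

(* Functions on [0,1] are represented by functions on the whole line of which
   only the values on [0,1] matter. *)
Definition orlicz_function (R : realType) (N : R -> R) : Prop :=
  [/\ {within `[0, 1], continuous N},
      {in `[0, 1] &, {homo N : s t / s < t}},
      @convex_function R R^o `[0, 1] N,
      N 0 = 0 & N 1 = 1].

Definition p_orlicz (R : realType) (p : R) (M : R -> R) : Prop :=
  orlicz_function (fun t => M (t `^ p^-1)).

(* The extension of M by +oo to ]1,+oo[ *)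
Definition orlicz_ext (R : realType) (M : R -> R) (t : R) : \bar R :=
  if t <= 1 then (M t)%:E else +oo%E.

Definition orlicz_modular (R : realType) (M : R -> R) (I : choiceType)
    (x : I -> R) (rho : R) : \bar R :=
  \esum_(j in [set: I]) orlicz_ext M (`|x j| / rho).

Definition ell (R : realType) (M : R -> R) (I : choiceType) : set (I -> R) :=
  [set x | exists rho, 0 < rho /\ (orlicz_modular M x rho < +oo)%E].

(* Only meaningful on [ell M I]: the real infimum of the empty set is 0. *)
Definition ell_norm (R : realType) (M : R -> R) (I : choiceType)
    (x : I -> R) : R :=
  inf [set rho | 0 < rho /\ (orlicz_modular M x rho <= 1)%E].

Definition orlicz_inv (R : realType) (M : R -> R) : R -> R :=
  'pinv_(fun=> 0) `[0, 1] M.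

Definition fundamental (R : realType) (M : R -> R) (t : R) : R :=
  1 / orlicz_inv M (1 / t).

(* A (quasi-normed) space is given by its set X of vectors inside an ambient
   vector space, and a quasi-norm nX of which only the values on X matter. *)
Definition unit_ball (R : realType) (U : lmodType R) (X : set U)
    (nX : U -> R) : set U :=
  [set x | X x /\ nX x <= 1].

Definition covered_by (R : realType) (U V : lmodType R)
    (X : set U) (nX : U -> R) (Y : set V) (nY : V -> R) (T : U -> V)
    (n : nat) (e : R) : Prop :=
  exists y : 'I_n -> V, (forall i, Y (y i)) /\
    T @` unit_ball X nX `<=`
      \bigcup_(i in [set: 'I_n]) [set y i + e *: b | b in unit_ball Y nY].

(* The infimum is taken in the extended reals, so that it is +oo when there
   is no admissible e. *)
Definition entropy_number (R : realType) (U V : lmodType R)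
    (X : set U) (nX : U -> R) (Y : set V) (nY : V -> R) (T : U -> V)
    (k : nat) : \bar R :=
  ereal_inf [set e%:E | e in
    [set e : R | 0 < e /\ covered_by X nX Y nY T (2 ^ k.-1)%N e]].

Definition log2 (R : realType) (x : R) : R := ln x / ln 2.

Definition cst_p (R : realType) (p : R) : R :=
  4 * 2 `^ (12 / p) * (log2 (24 / p)) `^ (2 / p) * (1 / p) `^ (1 / p).

Definition weight (R : realType) (M1 M2 : R -> R) (m i : nat) : R :=
  if (i <= m)%N
  then fundamental M1 (2 ^+ (m - i)) / fundamental M2 (2 ^+ (m - i))
  else 1.

(* Main.v *)
(** The weight on level [i] is [b_i / a_i], where [M1 a_i = M2 b_i = 2^-(m-i)],
    and the monotonicity of the ratio gives [M2 (b_i / a_i * t) <= M1 t] for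
    [t <= a_i]. Let [D = (3 / p)^(1 / p)]. For [x] with [sum_j M1 |x j| <= 1],
    replace each coordinate [x j] of level [i <= m] by its truncation to the
    lattice [D a_i Z]. The error after applying the weights, divided by [D], has
    [M2]-modular at most that of [x]: a coordinate below [a_i] becomes 0 and the
    previous inequality applies, and above [a_i] the error is at most [D b_i],
    with [M2 b_i = M1 a_i <= M1 |x j|].

    It remains to count the truncated vectors. Give the value [v] at a
    coordinate of level [i] the weight 1 if [v = 0] and
    [2^-(2^i+i) / (2|v|(|v|+1))] otherwise. Since [M1 |x j| >= 2^-(m-i) D^p |v|^p]
    and [D^p |v|^p >= 3 (1 + ln |v|)], each truncated vector has total weight
    (the product over coordinates) at least [exp (- 2^m)]. As level [i] has at
    most [2^(m+2^i)] coordinates, the weights of all integer vectors sum to at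
    most [prod_i (1 + 2^-(2^i+i))^(2^(m+2^i)) <= exp (2 * 2^m)], so there are at
    most [exp (3 * 2^m) <= 2^(10 * 2^m - 1)] truncated vectors. *)

Require Import Defs.
From HB Require Import structures.
From mathcomp Require Import all_boot all_order all_algebra.
From mathcomp Require Import all_classical all_reals all_analysis.
From mathcomp Require Import zify ring lra.

Import Order.TTheory GRing.Theory Num.Theory.
Import numFieldNormedType.Exports.

Set Implicit Arguments.
Unset Strict Implicit.
Unset Printing Implicit Defensive.

Local Open Scope classical_set_scope.
Local Open Scope ring_scope.

(** * Functions [N (t ^ p)] with [N] Orlicz: monotonicity, scaling and inverse *)

Lemma powR_le1 (R : realType) (r t : R) : 0 <= r -> 0 <= t <= 1 -> t `^ r <= 1.
Proof.
move=> r0 /andP[t0 t1]; have := ge0_ler_powR r0 (x := t) (y := 1).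
by rewrite powR1; apply; rewrite ?nnegrE.
Qed.

Section POrlicz.
Context (R : realType) (p : R) (M : R -> R).
Hypotheses (p_gt0 : 0 < p) (HM : p_orlicz p M).

Let N t := M (t `^ p^-1).

Let NE t : 0 <= t -> M t = N (t `^ p).
Proof. by move=> t0; rewrite /N -powRrM divff ?gt_eqF// powRr1. Qed.

Let pow01 t : 0 <= t <= 1 -> t `^ p \in `[0, 1].
Proof. by move=> t01; rewrite in_itv/= powR_ge0 powR_le1// ltW. Qed.

Lemma p_orlicz0 : M 0 = 0.
Proof.
by have [_ _ _ + _] := HM; rewrite powR0// invr_eq0 gt_eqF.
Qed.

Lemma p_orlicz1 : M 1 = 1.
Proof. by have [_ _ _ _] := HM; rewrite powR1. Qed.

Lemma p_orlicz_lt s t : 0 <= s -> s < t -> t <= 1 -> M s < M t.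
Proof.
move=> s0 st t1; have t0 : 0 <= t by rewrite (le_trans s0)// ltW.
have [_ Nlt _ _ _] := HM; rewrite !NE//; apply: Nlt.
- by apply: pow01; rewrite s0 (le_trans (ltW st)).
- by apply: pow01; rewrite t0 t1.
- by rewrite gt0_ltr_powR ?nnegrE.
Qed.

Lemma p_orlicz_le s t : 0 <= s -> s <= t -> t <= 1 -> M s <= M t.
Proof.
by move=> s0; rewrite le_eqVlt => /predU1P[->//|st] t1; rewrite ltW ?p_orlicz_lt.
Qed.

Lemma p_orlicz_ge0 t : 0 <= t <= 1 -> 0 <= M t.
Proof. by move=> /andP[t0 t1]; rewrite -p_orlicz0 p_orlicz_le. Qed.

Lemma p_orlicz_gt0 t : 0 < t -> t <= 1 -> 0 < M t.
Proof. by move=> t0 t1; rewrite -p_orlicz0 p_orlicz_lt. Qed.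

(** The function [N] is convex and vanishes at 0, so it shrinks at least by the factor [l ^ p] on
    the segment from 0 to [t ^ p]. *)
Lemma p_orlicz_scale l t : 0 <= l <= 1 -> 0 <= t <= 1 ->
  M (l * t) <= l `^ p * M t.
Proof.
move=> l01 t01; have [l0 l1] := andP l01; have [t0 t1] := andP t01.
have [_ _ Ncvx N0 _] := HM.
have := pow01 l01; rewrite in_itv/= => lp01.
(* The convexity hypothesis takes its coefficient as an interval-typed number, so [l ^ p] is
   packaged with its membership in [[0, 1]]. *)
have i1 : Itv.spec (@Itv.num_sem R) (Itv.Real `[0%Z, 1%Z]) (l `^ p).
  by rewrite /Itv.spec/= /Itv.num_sem/= num_real/= in_itv/=.
have z01 : (0 : R) \in `[0, 1] by rewrite in_itv/= lexx ler01.
have : N (l `^ p * t `^ p + (1 - l `^ p) * 0) <=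
    l `^ p * N (t `^ p) + (1 - l `^ p) * N 0.
  exact: (Ncvx (Itv.mk i1) _ _ (mem_set (pow01 t01)) (mem_set z01)).
by rewrite {3}/N N0 !mulr0 !addr0 -powRM// -!NE// mulr_ge0.
Qed.

Lemma p_orlicz_surj y : 0 <= y <= 1 -> exists2 t, 0 <= t <= 1 & M t = y.
Proof.
move=> y01; have [Nc _ _ N0 N1] := HM.
have [|t t01 <-] := IVT (@ler01 R) Nc (v := y); first by rewrite N0 N1 min_l ?max_r.
exists (t `^ p^-1) => //; rewrite powR_ge0/=.
by move: t01; rewrite in_itv/= => ?; rewrite powR_le1// invr_ge0 ltW.
Qed.

Lemma p_orliczK t : 0 <= t <= 1 -> orlicz_inv M (M t) = t.
Proof.
move=> t01; rewrite /orlicz_inv pinvKV//; last by rewrite inE/= in_itv.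
move=> x y; rewrite !inE/= !in_itv/= => /andP[x0 x1] /andP[y0 y1] xy.
by case: (ltgtP x y) => // /p_orlicz_lt; rewrite xy ltxx;
  [move=> /(_ x0 y1)|move=> /(_ y0 x1)].
Qed.

Lemma orlicz_inv_gt0 y : 0 < y <= 1 -> 0 < orlicz_inv M y <= 1.
Proof.
move=> /andP[y0 y1]; have [|t t01 ty] := p_orlicz_surj (y := y); first by rewrite ltW.
rewrite -ty p_orliczK//; case/andP: t01 => t0 t1; rewrite t1 andbT lt_neqAle t0 andbT.
by apply/eqP => t00; move: y0; rewrite -ty -t00 p_orlicz0 ltxx.
Qed.

Lemma orlicz_invK y : 0 < y <= 1 -> M (orlicz_inv M y) = y.
Proof.
move=> /andP[y0 y1]; have [|t t01 ty] := p_orlicz_surj (y := y); first by rewrite ltW.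
by rewrite -{1}ty p_orliczK.
Qed.

End POrlicz.

(** * Modulars and unit balls *)

Section Modular.
Context (R : realType) (p : R) (M : R -> R) (I : choiceType).
Hypotheses (p_gt0 : 0 < p) (HM : p_orlicz p M).
Implicit Types (x : I -> R).

Lemma orlicz_ext_ge0 t : 0 <= t -> (0 <= orlicz_ext M t)%E.
Proof.
move=> t0; rewrite /orlicz_ext; case: ifP => // t1.
by rewrite lee_fin (p_orlicz_ge0 p_gt0 HM)// t0.
Qed.

Lemma orlicz_ext_le s t : 0 <= s -> s <= t -> (orlicz_ext M s <= orlicz_ext M t)%E.
Proof.
move=> s0 st; rewrite /orlicz_ext; case: (leP t 1) => t1; last by rewrite leey.
by rewrite (le_trans st t1) lee_fin (p_orlicz_le p_gt0 HM).
Qed.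

Lemma orlicz_ext_scale l t : 0 < l <= 1 -> 0 <= t ->
  (orlicz_ext M (l * t) <= (l `^ p)%:E * orlicz_ext M t)%E.
Proof.
move=> /andP[l0 l1] t0; rewrite /orlicz_ext; case: (leP t 1) => t1; last first.
  by rewrite gt0_muley ?leey// lte_fin powR_gt0.
by rewrite mulr_ile1 ?(ltW l0)// -EFinM lee_fin p_orlicz_scale ?(ltW l0)// t0.
Qed.

Lemma le_orlicz_modular x r s : 0 < r -> r <= s ->
  (orlicz_modular M x s <= orlicz_modular M x r)%E.
Proof.
move=> r0 rs; apply: le_esum => j _; apply: orlicz_ext_le.
  by rewrite divr_ge0// (le_trans (ltW r0)).
by rewrite ler_wpM2l// lef_pV2 ?posrE// (lt_le_trans r0).
Qed.

Lemma orlicz_modular_sum x r (s : seq I) : uniq s ->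
  (\sum_(j <- s) orlicz_ext M (`|x j| / r) <= orlicz_modular M x r)%E.
Proof.
move=> us; apply: esum_ge; exists [set` s]; last by rewrite fsbig_seq.
by split => //; exact: finite_seq.
Qed.

Lemma orlicz_modular_le x r a :
  (forall s, uniq s -> (\sum_(j <- s) orlicz_ext M (`|x j| / r) <= a)%E) ->
  (orlicz_modular M x r <= a)%E.
Proof.
move=> H; apply: ge_ereal_sup => _ [X [finX _] <-].
by rewrite fsbig_finite//; apply: H; exact: finmap.fset_uniq.
Qed.

(** If the modular at scale [r] is [A], enlarging the scale by the factor [(A + 1) ^ (1 / p)]
    divides it by at least [A + 1]. *)
Lemma ell_modular_le1 x : ell M x ->
  exists r, 0 < r /\ (orlicz_modular M x r <= 1)%E.
Proof.
move=> [r [r0 xr]].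
have m0 : (0 <= orlicz_modular M x r)%E.
  by apply: esum_ge0 => j _; rewrite orlicz_ext_ge0// divr_ge0// ltW.
have : orlicz_modular M x r \is a fin_num by rewrite ge0_fin_numE.
move=> /fineK; set A := fine _ => EA.
have A0 : 0 <= A by rewrite /A fine_ge0.
pose l := (A + 1)^-1 `^ p^-1.
have lp : l `^ p = (A + 1)^-1.
  by rewrite /l -powRrM mulVf ?gt_eqF// powRr1// invr_ge0 addr_ge0.
have A1 : 0 < (A + 1)^-1 by rewrite invr_gt0 ltr_wpDl.
have l0 : 0 < l by rewrite powR_gt0.
have l1 : l <= 1.
  apply: powR_le1; first by rewrite invr_ge0 ltW.
  by rewrite (ltW A1) invf_le1 ?ltr_wpDl// lerDr.
exists (r / l); split; first by rewrite divr_gt0.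
apply: orlicz_modular_le => s us.
apply: (@le_trans _ _ ((A + 1)^-1%:E * orlicz_modular M x r)%E).
  apply: le_trans (lee_wpmul2l _ (orlicz_modular_sum x r us)); last first.
    by rewrite lee_fin ltW.
  rewrite ge0_sume_distrr; last first.
    by move=> j _; rewrite orlicz_ext_ge0// divr_ge0// ltW.
  apply: lee_sum => j _; rewrite invf_div mulrCA -lp.
  by apply: orlicz_ext_scale; [rewrite l0 | rewrite divr_ge0// ltW].
rewrite -EA -EFinM lee_fin mulrC ler_pdivrMr ?mul1r ?lerDl//.
by rewrite ltr_wpDl.
Qed.

(* At scale 2 instead of 1 this needs no continuity of the modular. *)
Lemma unit_ball_modular_le1 x : unit_ball (@ell R M I) (@ell_norm R M I) x ->
  (orlicz_modular M x 2 <= 1)%E.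
Proof.
move=> [/ell_modular_le1 [r rx] x1].
have [||e [e0 ex] e2] := @inf_adherent R
  [set r | 0 < r /\ (orlicz_modular M x r <= 1)%E] 1.
- by [].
- by split; [exists r|exists 0 => s [/ltW]].
apply: le_trans ex; apply: le_orlicz_modular => //.
by rewrite (le_trans (ltW e2))// -[leRHS]/(1 + 1) lerD2r.
Qed.

Lemma modular_le1_unit_ball x : (orlicz_modular M x 1 <= 1)%E ->
  unit_ball (@ell R M I) (@ell_norm R M I) x.
Proof.
move=> x1; split.
  by exists 1; split => //; rewrite (le_lt_trans x1)// ltry.
by apply: ge_inf => //; exists 0 => s [/ltW].
Qed.

(** Puts the centers of the covering in the target space. The scale [r] dominates every [|x j|], so
    no term of the finite sum is infinite. *)
Lemma finite_support_ell x : finite_set [set j | x j != 0] -> ell M x.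
Proof.
move=> finx; pose r := 1 + \sum_(j \in [set j | x j != 0]) `|x j|.
have r1 : 1 <= r by rewrite lerDl fsumr_ge0.
have r0 : 0 < r by rewrite (lt_le_trans _ r1).
exists r; split => //.
rewrite /orlicz_modular (_ : esum _ _ =
    \esum_(j in [set j | x j != 0]) orlicz_ext M (`|x j| / r)); last first.
  rewrite [RHS]esum_mkcond; apply: eq_esum => j _; case: ifPn => //.
  rewrite notin_setE/= => /negP; rewrite negbK => /eqP ->.
  by rewrite normr0 mul0r /orlicz_ext ler01 (p_orlicz0 p_gt0 HM).
rewrite esum_fset//; last by move=> j _; rewrite orlicz_ext_ge0// divr_ge0// ltW.
rewrite fsbig_finite//= big_seq; apply: lte_sum_pinfty => j.
rewrite in_fset_set// inE/= => xj.
suff : `|x j| / r <= 1 by rewrite /orlicz_ext => ->; rewrite ltry.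
rewrite ler_pdivrMr// mul1r /r fsbig_finite//=.
rewrite (big_rem j) ?in_fset_set ?inE//=.
by rewrite addrCA lerDl addr_ge0// sumr_ge0.
Qed.

End Modular.

(** * Levels and weights *)

(** The numbers [a_i] and [b_i] are [level M1 (m - i)] and [level M2 (m - i)]; each is the
    reciprocal of the fundamental function at [2 ^ (m - i)]. *)
Definition level (R : realType) (M : R -> R) (k : nat) : R :=
  orlicz_inv M (2 ^+ k)^-1.

Section Weights.
Context (R : realType) (p : R) (M1 M2 : R -> R).
Hypotheses (p_gt0 : 0 < p) (HM1 : p_orlicz p M1) (HM2 : p_orlicz p M2).
Hypothesis ratio_nondecreasing : forall s t : R, 1 <= s -> s <= t ->
  fundamental M1 s / fundamental M2 s <= fundamental M1 t / fundamental M2 t.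

Lemma invX2_itv k : 0 < (2 ^+ k : R)^-1 <= 1.
Proof. by rewrite invr_gt0 exprn_gt0//= invf_le1 ?exprn_gt0// exprn_ege1// ler1n. Qed.

Lemma level_itv M k : p_orlicz p M -> 0 < level M k <= 1.
Proof. by move=> HM; exact: (orlicz_inv_gt0 p_gt0 HM (invX2_itv k)). Qed.

Lemma levelK M k : p_orlicz p M -> M (level M k) = (2 ^+ k)^-1.
Proof. by move=> HM; exact: (orlicz_invK p_gt0 HM (invX2_itv k)). Qed.

Lemma level0 M : p_orlicz p M -> level M 0 = 1.
Proof.
move=> HM; rewrite /level expr0 invr1 -{1}(p_orlicz1 HM).
by rewrite (p_orliczK p_gt0 HM)// ler01 lexx.
Qed.

(* Truncated subtraction makes the formula valid for [m < i] too, where both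
   levels are 1. *)
Lemma weightE m i : weight M1 M2 m i = level M2 (m - i) / level M1 (m - i).
Proof.
rewrite /weight; case: leqP => im.
  by rewrite /fundamental !div1r invrK mulrC.
have -> : (m - i = 0)%N by apply/eqP; rewrite subn_eq0 ltnW.
by rewrite !level0// divr1.
Qed.

(** Comparing the ratio of fundamental functions at [2 ^ k] and at [1 / M1 t] gives
    [b / a <= c / t], where [M2 c = M1 t]. *)
Lemma weight_small k t : 0 <= t <= level M1 k ->
  M2 (level M2 k / level M1 k * t) <= M1 t.
Proof.
move=> /andP[]; rewrite le_eqVlt => /predU1P[<- _|t0 ta].
  by rewrite mulr0 (p_orlicz0 p_gt0 HM1) (p_orlicz0 p_gt0 HM2).
have /andP[a0 a1] := level_itv k HM1; have /andP[b0 b1] := level_itv k HM2.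
have t1 : t <= 1 := le_trans ta a1.
have s0 := p_orlicz_gt0 p_gt0 HM1 t0 t1.
have sk : M1 t <= (2 ^+ k)^-1.
  by rewrite -(levelK k HM1) (p_orlicz_le p_gt0 HM1)// ltW.
have s01 : 0 < M1 t <= 1.
  by rewrite s0 (le_trans sk)//; case/andP: (invX2_itv k).
have := @ratio_nondecreasing (2 ^+ k) (M1 t)^-1.
rewrite exprn_ege1 ?ler1n// => /(_ isT) H.
have /H{H} : 2 ^+ k <= (M1 t)^-1.
  by rewrite -[leLHS]invrK lef_pV2 ?posrE ?invr_gt0 ?exprn_gt0.
rewrite /fundamental !div1r !invrK -!/(level _ _).
rewrite (p_orliczK p_gt0 HM1) ?(ltW t0)//.
have /andP[c0 c1] := orlicz_inv_gt0 p_gt0 HM2 s01.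
rewrite mulrC [leRHS]mulrC ler_pdivlMr// => le_c.
rewrite -[leRHS](orlicz_invK p_gt0 HM2 s01) (p_orlicz_le p_gt0 HM2)//.
by rewrite mulr_ge0 ?divr_ge0// ltW.
Qed.

(** Here [t] is a coordinate and [z] its weighted truncation error. For [|t|] above the level, both
    modular terms are compared with the common value [2 ^ -k] of [M1] and [M2] at their levels. *)
Lemma quantization_error k D t z : 1 <= D -> `|t| <= 1 ->
  `|z| <= D * level M2 k ->
  (`|t| <= level M1 k -> z = level M2 k / level M1 k * t) ->
  (orlicz_ext M2 (`|z| / D) <= orlicz_ext M1 `|t|)%E.
Proof.
move=> D1 t1 zD zE; have D0 : 0 < D by rewrite (lt_le_trans _ D1).
have /andP[a0 a1] := level_itv k HM1; have /andP[b0 b1] := level_itv k HM2.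
have zb : `|z| / D <= level M2 k by rewrite ler_pdivrMr// mulrC.
have z0 : 0 <= `|z| / D by rewrite divr_ge0// ltW.
rewrite /orlicz_ext t1 (le_trans zb b1) lee_fin.
have [ta|/ltW at_] := leP `|t| (level M1 k); last first.
  apply: (@le_trans _ _ (M2 (level M2 k))); first exact: (p_orlicz_le p_gt0 HM2).
  by rewrite levelK// -(levelK k HM1) (p_orlicz_le p_gt0 HM1)// ltW.
apply: le_trans (weight_small (k := k) _); last by rewrite normr_ge0.
have w0 : 0 <= level M2 k / level M1 k by rewrite divr_ge0// ltW.
apply: (p_orlicz_le p_gt0 HM2) => //.
  by rewrite zE// normrM (ger0_norm w0) ler_pdivrMr// ler_peMr// mulr_ge0.
rewrite mulrAC -mulrA; apply: mulr_ile1 => //.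
- by rewrite ltW.
- by rewrite divr_ge0// ltW.
- by rewrite ler_pdivrMr// mul1r.
Qed.

End Weights.

(* The points of level [i <= m] inject into ['I_(2 ^ (m + 2 ^ i))]. *)
Notation grid m := {i : 'I_m.+1 & 'I_(2 ^ (m + 2 ^ i))}.

(** * Counting codes by their weight *)

Section Count.
Context (R : realType).

(* Markov's inequality for the counting measure. *)
Lemma card_prod_weight_ge (A V : finType) (q : A -> V -> R) (c : R) :
  (forall a v, 0 <= q a v) ->
  #|[set f : {ffun A -> V} | c <= \prod_a q a (f a)]%SET|%:R * c
    <= \prod_a \sum_v q a v.
Proof.
move=> q0; rewrite bigA_distr_bigA/= mulr_natl -sumr_const.
set G := finset _.
apply: (@le_trans _ _ (\sum_(f in G) \prod_a q a (f a))).
  by apply: ler_sum => f; rewrite inE.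
rewrite [leRHS](bigID (fun f => f \in G))/=.
by rewrite lerDl sumr_ge0// => f _; rewrite prodr_ge0.
Qed.

(* The weight of the signed integer (-1)^s k, where the redundant code
   [(true, 0)] of zero has weight 0. *)
Definition code_weight (c : R) (v : bool * nat) : R :=
  if v.2 == 0 then (~~ v.1)%:R else c / (2 * (v.2 * v.2.+1)%:R).

Lemma code_weight_ge0 c v : 0 <= c -> 0 <= code_weight c v.
Proof. by move=> c0; rewrite /code_weight; case: ifP => // _; rewrite divr_ge0. Qed.

(** The terms [1 / (k (k + 1))] telescope to at most 1, and the factor 2 in the denominator pays for
    the two signs. *)
Lemma sum_code_weight c L : 0 <= c ->
  \sum_(v : bool * 'I_L.+1) code_weight c (v.1, val v.2) <= 1 + c.
Proof.
move=> c0.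
have S : \sum_(k < L) c / (2 * (k.+1 * k.+2)%:R) = c / 2 * (1 - L.+1%:R^-1).
  elim: L => [|L IH]; first by rewrite big_ord0 invr1 subrr mulr0.
  rewrite big_ord_recr/= IH natrM -(natr1 L.+1) -(natr1 L).
  by field; rewrite -?natrD ?natr1 ?pnatr_eq0.
rewrite -(pair_big xpredT xpredT (fun s (k : 'I_L.+1) => code_weight c (s, val k)))/=.
rewrite big_bool/= !big_ord_recl /code_weight/= add0r.
under eq_bigr do rewrite /bump/= add1n.
rewrite S; have : c / 2 * (1 - L.+1%:R^-1) <= c / 2.
  by rewrite ler_piMr ?divr_ge0// gerBl.
move: (c / 2 * _) => d; lra.
Qed.

Lemma two_le_expR1 : 2 <= expR 1 :> R.
Proof. by rewrite -[leLHS]/(1 + 1) expR_ge1Dx. Qed.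

Lemma expR1_le4 : expR 1 <= 4 :> R.
Proof.
(* The bound [1 + x <= exp x] at [-1/2] gives [exp (1/2) <= 2], which is then squared. *)
have h : 2^-1 <= expR (- 2^-1) :> R by apply: le_trans (expR_ge1Dx _); lra.
have h2 : expR (2^-1) <= 2 :> R.
  by rewrite -[leLHS]invrK -expRN -[leRHS]invrK lef_pV2 ?posrE ?expR_gt0.
have -> : 1 = 2^-1 + 2^-1 :> R by lra.
rewrite expRD; have := expR_gt0 (2^-1 : R); nra.
Qed.

(** After inversion, the chain is [2^(2^i+i) * 2k(k+1) <= 2^(2^i+i+2) * k^2 <= exp (3 * 2^i + 2 ln
    k) <= exp (2^i * 3 (1 + ln k))]. *)
Lemma code_weight_cost p i s k : 0 < p <= 1 -> (0 < k)%N ->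
  expR (- (2 ^+ i * (3 / p * k%:R `^ p))) <=
  code_weight (2 ^+ (2 ^ i + i))^-1 (s, k) :> R.
Proof.
move=> /andP[p0 p1] k0; rewrite /code_weight/= gtn_eqF//.
have kR : 0 < k%:R :> R by rewrite ltr0n.
have lk : 0 <= ln k%:R :> R by rewrite ln_ge0// ler1n.
(* Since [p <= 1], [p (1 + ln k) <= 1 + p ln k <= exp (p ln k) = k ^ p]. *)
have kp : 3 * (1 + ln k%:R) <= 3 / p * k%:R `^ p :> R.
  rewrite /powR gt_eqF// mulrAC ler_pdivlMr// -mulrA ler_wpM2l//.
  apply: le_trans (expR_ge1Dx _); rewrite mulrDl mul1r [_ * p]mulrC lerD2r//.
have kE : k%:R ^+ 2 = expR (2 * ln k%:R) :> R by rewrite expRM_natl lnK.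
have i2 : (i.+1 <= 2 ^ i)%N by rewrite ltn_expl.
have E2 : (2 ^ i)%:R = 2 ^+ i :> R by rewrite natrX.
have i1 : 1 <= 2 ^+ i :> R by rewrite exprn_ege1// ler1n.
rewrite expRN -invfM lef_pV2 ?posrE ?expR_gt0//; last first.
  by rewrite !mulr_gt0 ?exprn_gt0// ltr0n muln_gt0 k0.
apply: (@le_trans _ _ (2 ^+ (2 ^ i + i + 2) * k%:R ^+ 2)).
  rewrite [2 ^+ (_ + 2)]exprD -!mulrA ler_wpM2l ?exprn_ge0// natrM -natr1 expr2.
  have : 1 <= k%:R :> R by rewrite ler1n.
  nra.
apply: (@le_trans _ _ (expR (3 * 2 ^+ i) * expR (2 * ln k%:R))).
  rewrite kE ler_wpM2r ?expR_ge0//.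
  rewrite -E2 -natrM -[X in expR X]mulr1 expRM_natl.
  apply: (@le_trans _ _ (expR 1 ^+ (2 ^ i + i + 2))).
    by rewrite lerXn2r ?nnegrE ?expR_ge0// two_le_expR1.
  apply: ler_weXn2l; first by apply: le_trans two_le_expR1; rewrite ler1n.
  by move: (2 ^ i)%N i2 => n; lia.
rewrite -expRD ler_expR.
apply: (@le_trans _ _ (2 ^+ i * (3 * (1 + ln k%:R)))); last first.
  by rewrite ler_wpM2l// (le_trans ler01).
nra.
Qed.

(** By [1 + x <= exp x] the product is bounded through a sum, to which level [i] contributes
    [2^(m+2^i) * 2^-(2^i+i) = 2^(m-i)]. *)
Lemma prod_levels_le m :
  \prod_(a : grid m)
    (1 + (2 ^+ (2 ^ tag a + tag a))^-1) <= expR (2 * 2 ^+ m) :> R.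
Proof.
apply: (@le_trans _ _ (expR (\sum_(a : grid m)
    (2 ^+ (2 ^ tag a + tag a))^-1))).
  rewrite expR_sum; apply: ler_prod => a _; rewrite expR_ge1Dx andbT.
  by rewrite addr_ge0// invr_ge0 exprn_ge0.
rewrite ler_expR.
rewrite -(sig_big_dep (J := fun i : 'I_m.+1 => 'I_(2 ^ (m + 2 ^ i)))
  xpredT (fun _ => xpredT)
  (fun i _ => (2 ^+ (2 ^ i + i))^-1))/=.
rewrite (eq_bigr (fun i : 'I_m.+1 => 2 ^+ m * (2 ^+ i)^-1)); last first.
  move=> i _; rewrite sumr_const card_ord -[_ *+ _]mulr_natr natrX !exprD.
  by field; rewrite !expf_neq0.
rewrite -mulr_sumr mulrC ler_wpM2r ?exprn_ge0//.
suff -> : \sum_(i < m.+1) (2 ^+ i)^-1 = 2 - 2 / 2 ^+ m.+1 :> R.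
  by rewrite gerBl divr_ge0 ?exprn_ge0.
elim: m => [|m IH]; first by rewrite big_ord1 expr0 expr1; field.
by rewrite big_ord_recr/= IH !exprS; field; rewrite expf_neq0.
Qed.

Definition prod_weight m L (f : {ffun grid m -> bool * 'I_L.+1}) : R :=
  \prod_(a : grid m) code_weight (2 ^+ (2 ^ tag a + tag a))^-1
                       ((f a).1, val (f a).2).

Lemma card_prod_weight_le m L :
  (#|[set f : {ffun grid m -> bool * 'I_L.+1} |
      (expR (- 2 ^+ m) <= prod_weight f)%R]%SET| <= 2 ^ (10 * 2 ^ m).-1)%N.
Proof.
set n := #|_|.
have c0 i : 0 <= (2 ^+ i : R)^-1 by rewrite invr_ge0 exprn_ge0.
have : n%:R * expR (- 2 ^+ m) <= expR (2 * 2 ^+ m) :> R.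
  apply: le_trans (prod_levels_le m).
  pose q (a : grid m) (v : bool * 'I_L.+1) : R :=
    code_weight (2 ^+ (2 ^ tag a + tag a))^-1 (v.1, val v.2).
  apply: (le_trans (@card_prod_weight_ge _ _ q _ _)).
    by move=> a v; exact: code_weight_ge0.
  apply: ler_prod => a _; rewrite sum_code_weight// andbT sumr_ge0// => v _.
  exact: code_weight_ge0.
rewrite expRN ler_pdivrMr ?expR_gt0// -expRD => le_n.
rewrite -(ler_nat R); apply: le_trans le_n _.
(* Since [exp 1 <= 4], the bound becomes [2^(6 * 2^m)], and [6 * 2^m <= 10 * 2^m - 1]. *)
have -> : 2 * 2 ^+ m + 2 ^+ m = (3 * 2 ^ m)%:R * 1 :> R.
  by rewrite natrM natrX; ring.
rewrite expRM_natl; apply: (@le_trans _ _ (4 ^+ (3 * 2 ^ m))).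
  by rewrite lerXn2r ?nnegrE ?expR_ge0// expR1_le4.
rewrite -natrX ler_nat -[4%N]/(2 ^ 2)%N -expnM leq_exp2l//.
by have := expn_gt0 2 m; move: (2 ^ m)%N => k; lia.
Qed.

End Count.

(** * Quantization of a single coordinate *)

Section Code.
Context (R : realType).

(* The sign is read off [t <= -1] rather than [t < 0], so that 0 has the single
   code [(false, 0)]. *)
Definition quant (t : R) : bool * nat := (t <= -1, Num.truncn `|t|).

Definition dequant (v : bool * nat) : R := (-1) ^+ v.1 * v.2%:R.

Lemma quant_small t : `|t| < 1 -> quant t = (false, 0%N).
Proof.
move=> t1; have : Num.truncn `|t| = 0%N by apply/truncn0Pn; rewrite -ltNge.
rewrite /quant => ->; move: t1; rewrite ltr_norml => /andP[t1 _].
by rewrite leNgt t1.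
Qed.

Lemma dequant_quant_error t : `|t - dequant (quant t)| <= 1.
Proof.
have [t1|t1] := ltP `|t| 1; first by rewrite quant_small// /dequant mulr0 subr0 ltW.
have /andP[] := truncn_itv (normr_ge0 t).
rewrite /dequant /quant/= -natr1; move: (_%:R) => k.
rewrite ler_norml; move: t1; rewrite ler_normr.
case: (ler0P t) => t0; case: (leP t (-1)) => t1; rewrite ?expr1 ?expr0; case/orP; lra.
Qed.

Context (p : R) (M : R -> R).
Hypotheses (p_gt0 : 0 < p) (p_le1 : p <= 1) (HM : p_orlicz p M).

(** This is the constant [D], chosen so that [D ^ p = 3 / p]. *)
Definition mesh : R := (3 / p) `^ p^-1.

Lemma mesh_powR : mesh `^ p = 3 / p.
Proof.
by rewrite /mesh -powRrM mulVf ?gt_eqF// powRr1// divr_ge0// ltW.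
Qed.

Lemma mesh_gt1 : 1 < mesh.
Proof.
have := @gt0_ltr_powR R p^-1 _ 1 (3 / p); rewrite powR1; apply;
  rewrite ?invr_gt0 ?nnegrE//.
  by rewrite divr_ge0// ltW.
by rewrite ltr_pdivlMr// mul1r (le_lt_trans p_le1)// ltr1n.
Qed.

(** It suffices that [3 <= 2 ^ 12] and that the logarithm in [cst_p] is at least 1. *)
Lemma mesh_le_cst : 2 * mesh <= cst_p p.
Proof.
have ln2 : 0 < ln 2 :> R by rewrite ln_gt0// ltr1n.
have l1 : 1 <= log2 (24 / p).
  rewrite /log2 ler_pdivlMr// mul1r ler_ln ?posrE//; last by rewrite divr_gt0.
  by rewrite ler_pdivlMr// (@le_trans _ _ (2 * 1))// ?ler_wpM2l// mulr1 ler_nat.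
have L1 : 1 <= log2 (24 / p) `^ (2 / p).
  by rewrite -[leLHS](powRr0 (log2 (24 / p))) ler_powR// divr_ge0// ltW.
rewrite /mesh powRM// ?invr_ge0 ?(ltW p_gt0)// /cst_p !div1r.
have T12 : 3 `^ p^-1 <= 2 `^ (12 / p) :> R.
  rewrite powRrM; apply: ge0_ler_powR; rewrite ?nnegrE ?powR_ge0 ?invr_ge0 ?(ltW p_gt0)//.
  by rewrite powR_mulrn//; rewrite -natrX ler_nat.
rewrite !mulrA ler_wpM2r ?powR_ge0//.
apply: (@le_trans _ _ (2 * 2 `^ (12 / p))); first by rewrite ler_wpM2l.
rewrite -[leLHS]mulr1; apply: ler_pM => //.
by rewrite ler_wpM2r ?powR_ge0// ler_nat.
Qed.

(** A nonzero code forces [|x| >= D a >= a], so scaling from [|x|] down to [a] gives [M |x| >=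
    2^-(m-i) (|x| / a)^p = 2^-(m-i) (3 / p) |t|^p]. The zero code has weight 1. *)
Lemma code_cost m i x : (i <= m)%N -> `|x| <= 1 ->
  expR (- (2 ^+ m * M `|x|)) <=
  code_weight (2 ^+ (2 ^ i + i))^-1 (quant (x / (mesh * level M (m - i)))).
Proof.
move=> im x1; set a := level M (m - i); set t := x / _.
have /andP[a0 a1] : 0 < a <= 1 := level_itv p_gt0 (m - i) HM.
have D1 := mesh_gt1; have D0 : 0 < mesh by lra.
have M0 : 0 <= M `|x| by rewrite (p_orlicz_ge0 p_gt0 HM)// normr_ge0.
have [t1|t1] := ltP `|t| 1.
  rewrite quant_small// /code_weight/= expR_le1 oppr_le0.
  by rewrite mulr_ge0 ?exprn_ge0.
have k0 : (0 < Num.truncn `|t|)%N by rewrite truncn_gt0.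
apply: le_trans (@code_weight_cost R p i _ _ _ k0); last by rewrite p_gt0.
rewrite ler_expR lerN2; set k := (Num.truncn _)%:R.
have kt : k <= `|t| by rewrite truncn_le.
have tE : `|t| = `|x| / (mesh * a).
  by rewrite normrM normfV [`|_ * a|]gtr0_norm// mulr_gt0.
have ax : mesh * a <= `|x|.
  by move: t1; rewrite tE ler_pdivlMr ?mul1r// mulr_gt0.
have x0 : 0 < `|x| by rewrite (lt_le_trans _ ax)// mulr_gt0.
have ax' : a <= `|x| by apply: le_trans ax; rewrite ler_peMl ?(ltW a0) ?(ltW D1).
have : M a <= (a / `|x|) `^ p * M `|x|.
  rewrite -{1}[a](divfK (lt0r_neq0 x0)); apply: (p_orlicz_scale p_gt0 HM).
    by rewrite divr_ge0 ?(ltW a0)//= ler_pdivrMr// mul1r.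
  by rewrite normr_ge0.
rewrite (levelK p_gt0 _ HM) => le_M.
have : (2 ^+ (m - i))^-1 * (`|x| / a) `^ p <= M `|x|.
  have -> : `|x| / a = (a / `|x|)^-1 by rewrite invf_div.
  rewrite -[(_ / _)^-1]powR_inv1 ?divr_ge0 ?(ltW a0)//.
  rewrite -powRrM mulN1r powRN ler_pdivrMr ?powR_gt0 ?divr_gt0//.
  by rewrite mulrC.
have -> : `|x| / a = mesh * `|t| by rewrite tE; field; rewrite !gt_eqF.
rewrite powRM ?(ltW D0)// mesh_powR => le_t.
apply: (@le_trans _ _ (2 ^+ i * (3 / p * `|t| `^ p))).
  rewrite ler_wpM2l ?exprn_ge0// ler_wpM2l ?divr_ge0 ?(ltW p_gt0)//.
  by rewrite ge0_ler_powR ?nnegrE// ltW.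
rewrite -(subnK im) exprD [2 ^+ (m - i) * _]mulrC -[leRHS]mulrA.
rewrite ler_wpM2l ?exprn_ge0// -ler_pdivrMl ?exprn_gt0//.
Qed.

End Code.

(** * Covering the image of the unit ball *)

Section Covering.
Context (R : realType) (p : R) (M1 M2 : R -> R).
Hypotheses (p_gt0 : 0 < p) (p_le1 : p <= 1).
Hypotheses (HM1 : p_orlicz p M1) (HM2 : p_orlicz p M2).
Hypothesis ratio_nondecreasing : forall s t : R, 1 <= s -> s <= t ->
  fundamental M1 s / fundamental M2 s <= fundamental M1 t / fundamental M2 t.
Context (m : nat) (I : choiceType) (lev : I -> nat) (idx : I -> option (grid m)).
Hypothesis idx_low : forall j, (lev j <= m)%N ->
  exists2 a, idx j = Some a & tag a = lev j :> nat.
Hypothesis idx_high : forall j, (m < lev j)%N -> idx j = None.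
Hypothesis idx_inj : forall j j' a, idx j = Some a -> idx j' = Some a -> j = j'.

Implicit Types (x : I -> R).

Let D := mesh p.
(** A bound on the codes at all levels: this sum dominates each [1 / a_i], truncated, and makes the
    set of codes finite. *)
Let L := (\sum_(k < m.+1) Num.truncn (level M1 k)^-1)%N.
Let code_type := {ffun grid m -> bool * 'I_L.+1}.

(** The leading factor 2 occurs because vectors of the unit ball have their modular controlled at
    scale 2, so that [x / 2] is what gets quantized. *)
Definition center (f : code_type) (j : I) : R :=
  if idx j is Some a
  then 2 * (D * level M2 (m - lev j) * dequant R ((f a).1, val (f a).2)) else 0.

(** A partial inverse of [idx], used to pass between products over the grid and sums over
    coordinates. *)
Let idxV_ex : exists s : grid m -> option I, forall a j, s a = Some j <-> idx j = Some a.
Proof.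
have /choice[s sP] : forall a, exists o, forall j, o = Some j <-> idx j = Some a.
  move=> a; have [[j ja]|noj] := pselect (exists j, idx j = Some a).
    by exists (Some j) => j'; split => [[<-]//|/(idx_inj ja)->].
  by exists None => j; split => // ja; case: noj; exists j.
by exists s.
Qed.

Lemma finite_support_center f : finite_set [set j | center f j != 0].
Proof.
have [s sP] := idxV_ex.
apply: (@sub_finite_set _ _ [set` pmap s (enum {: grid m})]); last exact: finite_seq.
move=> j; rewrite /= /center; case E: (idx j) => [a|]; last by rewrite eqxx.
by rewrite mem_pmap => _; apply/mapP; exists a; rewrite ?mem_enum//; apply/esym/sP.
Qed.

Let coord (x : I -> R) j := x j / 2 / (D * level M1 (m - lev j)).

Let D1 : 1 < D := mesh_gt1 p_gt0 p_le1.

Let ball_norm_le1 x j : (orlicz_modular M1 x 2 <= 1)%E -> `|x j / 2| <= 1.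
Proof.
move=> xb; have := le_trans (orlicz_modular_sum M1 x 2 (s := [:: j]) isT) xb.
rewrite big_seq1 /orlicz_ext normrM normfV [`|2|]gtr0_norm//.
by case: (leP (_ / 2) 1).
Qed.

Let trunc_coord x j : (orlicz_modular M1 x 2 <= 1)%E ->
  (Num.truncn `|coord x j| < L.+1)%N.
Proof.
move=> /(ball_norm_le1 j) x1; rewrite ltnS.
have /andP[a0 a1] := level_itv p_gt0 (m - lev j) HM1.
have km : (m - lev j < m.+1)%N by rewrite ltnS leq_subr.
rewrite /L (bigD1 (Ordinal km))//=; apply: (leq_trans _ (leq_addr _ _)).
apply: le_truncn; have D0 : 0 < D by rewrite (lt_trans _ D1).
rewrite normrM normfV [`|_ * level _ _|]gtr0_norm ?mulr_gt0// invfM mulrA.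
rewrite ler_piMl ?invr_ge0 ?(ltW a0)// ler_pdivrMr// mul1r.
exact: le_trans x1 (ltW D1).
Qed.

Lemma ball_code x : (orlicz_modular M1 x 2 <= 1)%E ->
  exists2 f : code_type, expR (- 2 ^+ m) <= prod_weight R f &
    forall j a, idx j = Some a -> ((f a).1, val (f a).2) = quant (coord x j).
Proof.
move=> xb; have [s sP] := idxV_ex.
(* Grid points that carry no coordinate receive the code of 0, whose weight is 1. *)
pose f : code_type := [ffun a => if s a is Some j then
  ((quant (coord x j)).1, inord (quant (coord x j)).2) else (false, ord0)].
have fE j a : idx j = Some a -> ((f a).1, val (f a).2) = quant (coord x j).
  by move=> /sP ja; rewrite ffunE ja/= inordK ?trunc_coord//; case: quant.
exists f => //.
pose h a := if s a is Some j then 2 ^+ m * M1 `|x j / 2| else 0.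
apply: (@le_trans _ _ (expR (\sum_a - h a))); last first.
  rewrite expR_sum; apply: ler_prod => a _; rewrite expR_ge0/= /h.
  case E: (s a) => [j|]; last first.
    by rewrite oppr0 expR0 /f ffunE E /code_weight/= lexx.
  have ja : idx j = Some a by apply/sP.
  rewrite (fE j a ja).
  have jm : (lev j <= m)%N by rewrite leqNgt; apply/negP => /idx_high; rewrite ja.
  have [a' + aj] := idx_low jm; rewrite ja => -[aa']; rewrite aa' aj.
  exact: code_cost (ball_norm_le1 _ xb).
rewrite ler_expR sumrN lerN2.
(* The indexed coordinates, each listed once: the total cost over the grid becomes [2 ^ m] times a
   partial sum of the modular, hence is at most [2 ^ m]. *)
pose r := pmap s (enum {: grid m}).
have ur : uniq r.
  have a0 : grid m by exists ord0; exists 0%N; rewrite expn_gt0.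
  apply: (@pmap_uniq _ _ s (fun j => odflt a0 (idx j))); last exact: enum_uniq.
  by move=> a; case E: (s a) => [j|]//=; move/sP : E => ->.
have : (\sum_(j <- r) M1 `|x j / 2| <= 1).
  rewrite -lee_fin -sumEFin.
  apply: le_trans (le_trans (orlicz_modular_sum M1 x 2 ur) xb).
  apply: lee_sum => j _; have := ball_norm_le1 j xb.
  by rewrite normrM normfV [`|2|]gtr0_norm// /orlicz_ext => ->.
suff -> : \sum_a h a = 2 ^+ m * \sum_(j <- r) M1 `|x j / 2|.
  by move=> le1; rewrite -[leRHS]mulr1 ler_wpM2l ?exprn_ge0.
rewrite /r big_pmap mulr_sumr big_enum; apply: eq_bigr => a _.
by rewrite /h; case: (s a) => [j|]//=; rewrite mulr0.
Qed.

Lemma center_error x (f : code_type) (T : (I -> R) -> I -> R) :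
  (orlicz_modular M1 x 2 <= 1)%E ->
  (forall j, T x j = weight M1 M2 m (lev j) * x j) ->
  (forall j a, idx j = Some a -> ((f a).1, val (f a).2) = quant (coord x j)) ->
  (orlicz_modular M2 (fun j => ((T x j - center f j) / (2 * D))%R) 1 <= 1)%E.
Proof.
move=> xb TE fE; apply: le_trans (xb); apply: le_esum => j _.
have D0 : 0 < D by rewrite (lt_trans _ D1).
have x1 := ball_norm_le1 j xb.
set k := (m - lev j)%N.
have /andP[a0 a1] := level_itv p_gt0 k HM1.
have /andP[b0 b1] := level_itv p_gt0 k HM2.
have -> : `|x j| / 2 = `|x j / 2| by rewrite normrM normfV [`|2|]gtr0_norm.
pose z := level M2 k / level M1 k * (x j / 2) - center f j / 2.
have -> : `|(T x j - center f j) / (2 * D)| / 1 = `|z| / D.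
  rewrite divr1 TE (weightE p_gt0 HM1 HM2) -/k.
  rewrite -[X in _ = _ / X](gtr0_norm D0) -normfV -normrM /z; congr (`| _ |).
  by field; rewrite !gt_eqF.
apply: (quantization_error p_gt0 HM1 HM2 ratio_nondecreasing (k := k)) => //.
- exact: ltW.
- rewrite /z /center; case E: (idx j) => [a|].
    rewrite (fE _ _ E).
    have -> : level M2 k / level M1 k * (x j / 2) -
        2 * (D * level M2 (m - lev j) * dequant R (quant (coord x j))) / 2 =
        D * level M2 k * (coord x j - dequant R (quant (coord x j))).
      by rewrite /coord -/k; field; rewrite !gt_eqF.
    rewrite normrM [`|D * _|]gtr0_norm ?mulr_gt0//.
    by rewrite ler_piMr ?dequant_quant_error// mulr_ge0 ?ltW.
  (* An unindexed coordinate lies above level [m]. Its weight is 1 and its center 0, so the error is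
     [x j / 2] itself, bounded by [1 <= D]. *)
  have k0 : k = 0%N.
    rewrite /k; case: (leqP (lev j) m) => [/idx_low[a]|/ltnW]; first by rewrite E.
    by rewrite -subn_eq0 => /eqP.
  rewrite k0 (level0 p_gt0 HM1) (level0 p_gt0 HM2) mul0r subr0 divr1 mul1r mulr1.
  exact: le_trans x1 (ltW D1).
(* Since [D > 1], a coordinate of size at most [a] lies strictly below the mesh [D a] and is
   truncated to 0. *)
- move=> xa; rewrite /z /center; case E: (idx j) => [a|]; last by rewrite mul0r subr0.
  rewrite (fE _ _ E) quant_small ?[dequant _ _]mulr0 ?mulr0 ?mul0r ?subr0//.
  rewrite /coord -/k normrM normfV [`|_ * level _ _|]gtr0_norm ?mulr_gt0//.
  rewrite ltr_pdivrMr ?mulr_gt0// mul1r (le_lt_trans xa)//.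
  by rewrite ltr_pMl.
Qed.

Lemma covering (T : (I -> R) -> I -> R) :
  (forall x j, T x j = weight M1 M2 m (lev j) * x j) ->
  Defs.covered_by (@ell R M1 I) (@ell_norm R M1 I) (@ell R M2 I) (@ell_norm R M2 I) T
    (2 ^ (10 * 2 ^ m).-1) (2 * D).
Proof.
move=> TE.
pose G := [set f : code_type | expR (- 2 ^+ m) <= prod_weight R f]%SET.
have GN : (#|G| <= 2 ^ (10 * 2 ^ m).-1)%N := card_prod_weight_le R m L.
(* The list of admissible codes may be shorter than the prescribed number of centers; the default of
   [nth] repeats the zero code. *)
exists (fun i => center (nth [ffun=> (false, ord0)] (enum G) i)); split.
  by move=> i; apply: (finite_support_ell p_gt0 HM2); exact: finite_support_center.
move=> _ [x /(unit_ball_modular_le1 p_gt0 HM1) xb <-].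
have [f fG fE] := ball_code xb.
have fG' : f \in enum G by rewrite mem_enum inE.
have lt_i : (index f (enum G) < 2 ^ (10 * 2 ^ m).-1)%N.
  by apply: leq_trans GN; rewrite cardE index_mem.
exists (Ordinal lt_i) => //=; rewrite nth_index//.
exists (fun j => (T x j - center f j) / (2 * D)).
  exact: modular_le1_unit_ball (center_error xb (TE x) fE).
have D0 : 0 < D by rewrite (lt_trans _ D1).
apply/funext => j.
rewrite -[LHS]/(center f j + 2 * D * ((T x j - center f j) / (2 * D))).
by rewrite [2 * D * _]mulrC divfK ?subrKC// gt_eqF// mulr_gt0.
Qed.

End Covering.

(** * Indexing the sets [F i] by the grid, and conclusion *)

(** The injections of the individual sets are tagged by their level; equal grid points have equal
    tags, hence come from the same [F i], where injectivity applies. *)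
Lemma grid_index (m : nat) (J : choiceType) (F : 'I_m.+2 -> set J) :
  (forall i : 'I_m.+2, (i <= m)%N -> (F i #<= `I_(2 ^ (m + 2 ^ i)))%card) ->
  exists idx : 'I_m.+2 -> J -> option (grid m),
    [/\ forall (i : 'I_m.+2) j, (i <= m)%N -> F i j ->
          exists2 a, idx i j = Some a & tag a = i :> nat,
        forall (i : 'I_m.+2) j, (m < i)%N -> idx i j = None
      & forall i i' j j' a, F i j -> F i' j' ->
          idx i j = Some a -> idx i' j' = Some a -> j = j'].
Proof.
move=> Fc.
have /choice[g gP] : forall i : 'I_m.+2, exists g : J -> nat, (i <= m)%N ->
    (forall j, F i j -> g j < 2 ^ (m + 2 ^ i))%N /\ {in F i &, injective g}.
  move=> i; have [im|im] := leqP i m; last by exists (fun=> 0%N).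
  have /pcard_leP[g] := Fc i im; exists g => _; split; last exact: 'inj_g.
  by move=> j Fj; exact: ('funS_g Fj).
(* Levels range over ['I_m.+2] but tags over ['I_m.+1], so [inord] converts; on [F i] the bound on
   [g i] makes [insub] succeed. *)
pose idx (i : 'I_m.+2) j : option (grid m) := if (i <= m)%N then
  omap (Tagged (fun i : 'I_m.+1 => 'I_(2 ^ (m + 2 ^ i))))
    (insub (g i j) : option 'I_(2 ^ (m + 2 ^ (inord i : 'I_m.+1)))) else None.
have idxE i j a : idx i j = Some a -> tag a = i :> nat /\ tagged a = g i j :> nat.
  rewrite /idx; case: leqP => // im; case: insubP => //= k _ <- [<-]/=.
  by split => //; exact: inordK.
exists idx; split.
- move=> i j im Fij; rewrite /idx im; have [glt _] := gP i im.
  have glt' : (g i j < 2 ^ (m + 2 ^ (inord i : 'I_m.+1)))%N.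
    by rewrite inordK ?ltnS// glt.
  by rewrite insubT/=; eexists; [reflexivity|rewrite /= inordK].
- by move=> i j im; rewrite /idx leqNgt im.
- move=> i i' j j' a Fj Fj' /[dup] ai /idxE[ti gi] /idxE[ti' gi'].
  have im : (i <= m)%N by rewrite -ti -ltnS ltn_ord.
  have ii' : i' = i by apply/val_inj; rewrite /= -ti' -ti.
  move: Fj' gi'; rewrite ii' => Fj' gi'.
  have [_ ginj] := gP i im; apply: ginj; rewrite ?inE// -gi -gi'//.
Qed.

Theorem lemma3p13 (R : realType) (p : R) (M1 M2 : R -> R)
  (p_gt0 : 0 < p) (p_le1 : p <= 1)
  (M1_orlicz : p_orlicz p M1) (M2_orlicz : p_orlicz p M2)
  (ratio_nondecreasing : forall s t : R, 1 <= s -> s <= t ->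
     fundamental M1 s / fundamental M2 s <= fundamental M1 t / fundamental M2 t)
  (m : nat) (m_ge5 : (5 <= m)%N)
  (J : choiceType) (F : 'I_m.+2 -> set J)
  (F_nonempty : forall i, F i !=set0)
  (F_disjoint : trivIset [set: 'I_m.+2] F)
  (F_countable : forall i, countable (F i))
  (F_card : forall i : 'I_m.+2, (i <= m)%N -> (F i #<= `I_(2 ^ (m + 2 ^ i)))%card)
  (E : set J) (E_def : E = \bigcup_(i in [set: 'I_m.+2]) F i)
  (T : (E -> R) -> (E -> R))
  (T_def : forall (x : E -> R) (i : 'I_m.+2) (j : E), F i (\val j) ->
     T x j = weight M1 M2 m i * x j) :
  (entropy_number (ell M1 (I:=E)) (ell_norm M1 (I:=E))
     (ell M2 (I:=E)) (ell_norm M2 (I:=E)) T (10 * 2 ^ m)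
   <= (cst_p p)%:E)%E.
Proof.
have [idx [idx_low idx_high idx_inj]] := grid_index F_card.
have /choice[lev levP] : forall j : E, exists i, F i (\val j).
  move=> j; have : (\bigcup_(i in [set: 'I_m.+2]) F i) (\val j).
    by rewrite -E_def; exact: set_valP.
  by move=> [i _ Fij]; exists i.
(* The covering radius obtained is [2 * mesh p]: the factor 2 comes from the scale of the modular,
   and [mesh p] from the truncation error. *)
apply: (@le_trans _ _ (2 * mesh p)%:E); last by rewrite lee_fin mesh_le_cst.
apply: ereal_inf_lbound; exists (2 * mesh p) => //; split.
  by rewrite mulr_gt0// (lt_trans _ (mesh_gt1 p_gt0 p_le1)).
apply: (covering p_gt0 p_le1 M1_orlicz M2_orlicz ratio_nondecreasing
  (lev := fun j => lev j) (idx := fun j => idx (lev j) (\val j))).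
- by move=> j /idx_low; apply.
- by move=> j /idx_high.
- move=> j j' a ja ja'; apply/val_inj.
  exact: idx_inj (levP j) (levP j') ja ja'.
- by move=> x j; apply: T_def.
Qed.
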